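(* Let $F$ be a field with a nontrivial valuation $v$ and valuation domain $O_v$. Let $R$ be an $O_v$-algebra and let $w$ be a $v$-quasi-valuation on $R$ (with respect to $O_v$) such that $w(1_R)=0$ and $w(x)\neq\infty$ for all nonzero $x\in R$. Assume that $R$ is right (or left) artinian and that the value monoid $M_w$ is cancellative. Then $O_w$ satisfies GU (going up) over $O_v$.
   Context: $\subset$ means proper inclusion. Rings are associative with $1$, not necessarily commutative; $\operatorname{Spec}$ denotes the set of prime (two-sided) ideals. $\Gamma_v$ is the value group of $v$, $O_v=\{x\in F: v(x)\ge0\}$. An $O_v$-algebra is a ring $R$ with a unitary ring homomorphism $O_v\to Z(R)$, $c\mapsto c\cdot 1_R$. A quasi-valuation on a ring $R$ is a map $w:R\to M\cup\{\infty\}$, where $M$ is a totally ordered abelian monoid and $\infty$ is an adjoined element greater than all of $M$, such that $w(0)=\infty$, $w(xy)\ge w(x)+w(y)$ and $w(x+y)\ge\min\{w(x),w(y)\}$ for all $x,y\in R$. It is a $v$-quasi-valuation with respect to $O_v$ if (with $M$ containing $\Gamma_v$ as an ordered submonoid) $w(cx)=v(c)+w(x)$ for all $c\in O_v$, $x\in R$. $M_w$ is the submonoid of $M$ generated by $w(R\setminus\{0\})$ (here all these values lie in $M$). $O_w=\{x\in R: w(x)\ge0\}$ is the quasi-valuation ring, an $O_v$-subalgebra of $R$. An ideal $Q$ of an $O_v$-algebra $T$ is lying over $P$ if $P=\{c\in O_v: c\cdot 1_T\in Q\}$. $T$ satisfies GU over $O_v$ if for any $P_1\subset P_2$ in $\operatorname{Spec}(O_v)$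 and every $Q_1\in\operatorname{Spec}(T)$ lying over $P_1$ there exists $Q_2\in\operatorname{Spec}(T)$ lying over $P_2$ with $Q_1\subset Q_2$. *)

(* Defs.v *)
From HB Require Import structures.
From mathcomp Require Import all_boot all_order all_algebra.
From mathcomp Require Import boolp classical_sets.

Set Implicit Arguments.
Unset Strict Implicit.
Unset Printing Implicit Defensive.

Import Order.TTheory GRing.Theory.
Local Open Scope classical_set_scope.
Local Open Scope ring_scope.

(* The addition of a totally ordered abelian monoid is introduced here rather
   than inherited from [nmodType], because no structure of the library lies
   below [Num.POrderedZmodule] and joins an order to an additive monoid. The
   [nmodType] and [zmodType] instances declared below recover the usual
   notations and lemmas. *)
HB.mixin Record isOrderedMonoid M of Order.Total ring_display M := {
  om_zero : M;
  om_add : M -> M -> M;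
  om_addA : associative om_add;
  om_addC : commutative om_add;
  om_add0 : left_id om_zero om_add;
  om_le_add2r : forall z x y : M, x <= y -> om_add x z <= om_add y z
}.

#[short(type="orderedMonoidType")]
HB.structure Definition OrderedMonoid :=
  { M of Order.Total ring_display M & isOrderedMonoid M }.

HB.instance Definition _ (M : orderedMonoidType) :=
  GRing.isNmodule.Build (OrderedMonoid.sort M)
    (@om_addA M) (@om_addC M) (@om_add0 M).

HB.mixin Record OrderedMonoid_isGroup G of OrderedMonoid G := {
  og_opp : G -> G;
  og_addN : left_inverse (om_zero : G) og_opp om_add
}.

#[short(type="orderedGroupType")]
HB.structure Definition OrderedGroup :=
  { G of OrderedMonoid G & OrderedMonoid_isGroup G }.

HB.instance Definition _ (G : orderedGroupType) :=
  GRing.isZmodule.Build (OrderedGroup.sort G)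
    (@om_addA G) (@om_addC G) (@om_add0 G) (@og_addN G).

Lemma le_add2r (M : orderedMonoidType) (z x y : M) :
  x <= y -> x + z <= y + z.
Proof. exact: om_le_add2r. Qed.

(* The monoid [M] with a greatest, absorbing element adjoined. *)
Inductive withTop (M : Type) := FinVal of M | Infty.
Arguments FinVal {M} m.
Arguments Infty {M}.

Definition withTop_map (M N : Type) (f : M -> N) (x : withTop M) : withTop N :=
  if x is FinVal m then FinVal (f m) else Infty.

Definition option_of_withTop (M : Type) (x : withTop M) : option M :=
  if x is FinVal m then Some m else None.
Definition withTop_of_option (M : Type) (x : option M) : withTop M :=
  if x is Some m then FinVal m else Infty.
Lemma option_of_withTopK (M : Type) :
  cancel (@option_of_withTop M) (@withTop_of_option M).
Proof. by case. Qed.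

HB.instance Definition _ (M : choiceType) :=
  Choice.copy (withTop M) (can_type (@option_of_withTopK M)).

Section WithTop.
Variable M : orderedMonoidType.
Implicit Types x y z : withTop M.

Definition withTop_le x y : bool :=
  match x, y with
  | _, Infty => true
  | Infty, FinVal _ => false
  | FinVal a, FinVal b => a <= b
  end.

Fact withTop_le_refl : reflexive withTop_le.
Proof. by case=> //= a; exact: lexx. Qed.

Fact withTop_le_anti : antisymmetric withTop_le.
Proof. by move=> [a|] [b|] //= /le_anti ->. Qed.

Fact withTop_le_trans : transitive withTop_le.
Proof. by move=> [b|] [a|] [c|] //=; exact: le_trans. Qed.

Fact withTop_le_total : total withTop_le.
Proof. by move=> [a|] [b|] //=; exact: le_total. Qed.

HB.instance Definition _ := Order.Le_isPOrder.Build ring_display (withTop M)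
  withTop_le_refl withTop_le_anti withTop_le_trans.
HB.instance Definition _ :=
  Order.POrder_isTotal.Build ring_display (withTop M) withTop_le_total.

Definition withTop_add x y : withTop M :=
  match x, y with
  | FinVal a, FinVal b => FinVal (a + b)
  | _, _ => Infty
  end.

Fact withTop_addA : associative withTop_add.
Proof. by move=> [a|] [b|] [c|] //=; rewrite addrA. Qed.

Fact withTop_addC : commutative withTop_add.
Proof. by move=> [a|] [b|] //=; rewrite addrC. Qed.

Fact withTop_add0 : left_id (FinVal 0) withTop_add.
Proof. by case=> //= a; rewrite add0r. Qed.

HB.instance Definition _ := GRing.isNmodule.Build (withTop M)
  withTop_addA withTop_addC withTop_add0.

Fact withTop_le_add2r z x y : x <= y -> x + z <= y + z.
Proof. by case: x y z => [a|] [b|] [c|] //; exact: le_add2r. Qed.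

HB.instance Definition _ := isOrderedMonoid.Build (withTop M)
  withTop_addA withTop_addC withTop_add0 withTop_le_add2r.

Lemma le_Infty x : x <= Infty.
Proof. by case: x. Qed.

End WithTop.

(* Surjectivity onto the finite values says that [G] is the value group. *)
Record valuation (F : fieldType) (G : orderedGroupType) := Valuation {
  valuation_fun :> F -> withTop G;
  valuation_eq_Infty : forall x, valuation_fun x = Infty <-> x = 0;
  valuationM : forall x y,
    valuation_fun (x * y) = valuation_fun x + valuation_fun y;
  valuationD : forall x y,
    Order.min (valuation_fun x) (valuation_fun y) <= valuation_fun (x + y);
  valuation_surj : forall g : G, exists x, valuation_fun x = FinVal g
}.

Definition nontrivial_valuation (F : fieldType) (G : orderedGroupType)
  (v : valuation F G) : Prop := exists x, x != 0 /\ v x <> 0.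

Section ValuationRing.
Variables (F : fieldType) (G : orderedGroupType) (v : valuation F G).

Lemma valuation1 : v 1 = 0.
Proof.
have := valuationM v 1 1; rewrite mulr1.
have := valuation_eq_Infty v 1; case: (v 1) => [a _|[/(_ erefl)/eqP]]; last by rewrite oner_eq0.
  by case=> /(congr1 (fun b => b - a)) /=; rewrite addrK subrr => <-.
Qed.

Lemma valuationN1 : v (- 1) = 0.
Proof.
have := valuationM v (- 1) (- 1); rewrite mulrNN mulr1 valuation1.
case: (v (- 1)) => // a [aa0]; congr FinVal.
have /orP[a0|a0] := le_total a 0.
  by apply/le_anti; rewrite a0; have := le_add2r a a0; rewrite add0r -aa0.
by apply/le_anti; rewrite a0 andbT; have := le_add2r a a0; rewrite add0r -aa0.
Qed.

Definition valuation_ring_pred : {pred F} := [pred x | FinVal 0 <= v x].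

Fact valuation_ring_subring_closed : subring_closed valuation_ring_pred.
Proof.
have vM x y : FinVal 0 <= v x -> FinVal 0 <= v y -> FinVal 0 <= v (x * y).
  move=> x0 y0; rewrite valuationM; apply: le_trans y0 _.
  by have := le_add2r (v y) x0; rewrite add0r.
split=> [|x y|x y]; rewrite ?inE ?valuation1 //; last exact: vM.
move=> x0 y0; apply: le_trans (valuationD v x (- y)).
rewrite le_min x0 -mulN1r vM // valuationN1.
exact: lexx.
Qed.

HB.instance Definition _ :=
  GRing.isSubringClosed.Build F valuation_ring_pred
    valuation_ring_subring_closed.

Record valuation_ring := ValuationRing {
  valuation_ring_val :> F;
  _ : valuation_ring_val \in valuation_ring_pred
}.

HB.instance Definition _ := [isSub for valuation_ring_val].
HB.instance Definition _ := [Choice of valuation_ring by <:].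
HB.instance Definition _ :=
  [SubChoice_isSubComNzRing of valuation_ring by <:].

End ValuationRing.

Section Ideals.
Variable T : pzRingType.
Implicit Types I J P : set T.

Definition right_ideal I : Prop :=
  [/\ I 0, forall x y, I x -> I y -> I (x + y) & forall x a, I x -> I (x * a)].

Definition left_ideal I : Prop :=
  [/\ I 0, forall x y, I x -> I y -> I (x + y) & forall a x, I x -> I (a * x)].

Definition ideal I : Prop := left_ideal I /\ right_ideal I.

(* Primeness in a noncommutative ring is tested on ideals, not on elements. *)
Definition prime_ideal P : Prop :=
  [/\ ideal P, P <> setT &
    forall I J, ideal I -> ideal J ->
      (forall x y, I x -> J y -> P (x * y)) -> I `<=` P \/ J `<=` P].

Definition dcc (C : set (set T)) : Prop :=
  forall I : nat -> set T, (forall n, C (I n)) ->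
    (forall n, I n.+1 `<=` I n) ->
    exists n, forall m, (n <= m)%N -> I m = I n.

Definition right_artinian : Prop := dcc right_ideal.
Definition left_artinian : Prop := dcc left_ideal.

End Ideals.

Definition lying_over (A : comPzRingType) (T : algType A)
  (Q : set T) (P : set A) : Prop := P = [set c | Q c%:A].

Definition going_up (A : comPzRingType) (T : algType A) : Prop :=
  forall P1 P2 : set A, prime_ideal P1 -> prime_ideal P2 -> P1 `<` P2 ->
  forall Q1 : set T, prime_ideal Q1 -> lying_over Q1 P1 ->
  exists Q2 : set T, [/\ prime_ideal Q2, lying_over Q2 P2 & Q1 `<` Q2].

Definition quasi_valuation (R : pzRingType) (M : orderedMonoidType)
  (w : R -> withTop M) : Prop :=
  [/\ w 0 = Infty, forall x y, w x + w y <= w (x * y) &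
      forall x y, Order.min (w x) (w y) <= w (x + y)].

Record ordered_embedding (G M : orderedMonoidType) := OrderedEmbedding {
  embedding_fun :> G -> M;
  embedding0 : embedding_fun 0 = 0;
  embeddingD : forall g h,
    embedding_fun (g + h) = embedding_fun g + embedding_fun h;
  embedding_le : forall g h, (embedding_fun g <= embedding_fun h) = (g <= h)
}.

Section QuasiValuation.
Variables (F : fieldType) (G : orderedGroupType) (v : valuation F G).
Variables (R : algType (valuation_ring v)) (M : orderedMonoidType).
Variable i : ordered_embedding G M.

Record v_quasi_valuation := VQuasiValuation {
  v_quasi_valuation_fun :> R -> withTop M;
  v_quasi_valuationP : quasi_valuation v_quasi_valuation_fun;
  v_quasi_valuationZ : forall (c : valuation_ring v) (x : R),
    v_quasi_valuation_fun (c *: x) =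
      withTop_map i (v (val c)) + v_quasi_valuation_fun x
}.

Variable w : v_quasi_valuation.

Definition submonoid (S : set M) : Prop :=
  S 0 /\ forall m n, S m -> S n -> S (m + n).

Definition value_monoid : set M :=
  smallest submonoid [set m | exists2 x : R, x != 0 & w x = FinVal m].

Definition cancellative (S : set M) : Prop :=
  forall a b c, S a -> S b -> S c -> a + c = b + c -> a = b.

(* The proof that [w 1 = 0] is a dummy argument: without it the set of elements
   of nonnegative value is not a unital subalgebra, so the instances below have
   to depend on it. *)
Definition quasi_valuation_ring_pred (w1 : w 1 = 0) : {pred R} :=
  [pred x | FinVal 0 <= w x].

Variable w1 : w 1 = 0.

Fact quasi_valuation_ring_subalg_closed :
  subalg_closed (quasi_valuation_ring_pred w1).
Proof.
have [_ wM wD] := v_quasi_valuationP w.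
have le0D (a b : withTop M) :
    FinVal 0 <= a -> FinVal 0 <= b -> FinVal 0 <= a + b.
  move=> a0 b0; apply: le_trans b0 _.
  by have := le_add2r b a0; rewrite add0r.
split=> [|c x y|x y]; rewrite ?inE ?w1 //.
  move=> x0 y0; apply: le_trans (wD _ _); rewrite le_min y0 andbT.
  rewrite v_quasi_valuationZ le0D //.
  case: c => c /=; rewrite inE; case: (v c) => //= a a0.
  by have: (0 : M) <= i a by rewrite -(embedding0 i) embedding_le.
by move=> x0 y0; apply: le_trans (wM _ _); exact: le0D.
Qed.

HB.instance Definition _ :=
  GRing.isSubalgClosed.Build (valuation_ring v) R (quasi_valuation_ring_pred w1)
    quasi_valuation_ring_subalg_closed.

Record quasi_valuation_ring := QuasiValuationRing {
  quasi_valuation_ring_val :> R;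
  _ : quasi_valuation_ring_val \in quasi_valuation_ring_pred w1
}.

HB.instance Definition _ := [isSub for quasi_valuation_ring_val].
HB.instance Definition _ := [Choice of quasi_valuation_ring by <:].
HB.instance Definition _ :=
  [SubChoice_isSubNzRing of quasi_valuation_ring by <:].
HB.instance Definition _ :=
  [SubNmodule_isSubLSemiModule of quasi_valuation_ring by <:].
HB.instance Definition _ :=
  [SubNzSemiRing_SubLSemiModule_isSubLSemiAlgebra of quasi_valuation_ring
     by <:].
HB.instance Definition _ :=
  [SubLSemiAlgebra_isSubSemiAlgebra of quasi_valuation_ring by <:].

End QuasiValuation.

Arguments valuation_ring {F G} v.
Arguments ordered_embedding G M : clear implicits.
Arguments value_monoid {F G v R M i} w.
Arguments quasi_valuation_ring {F G v R M i} w w1.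
Arguments right_artinian T : clear implicits.
Arguments left_artinian T : clear implicits.
Arguments going_up A T : clear implicits.

(* Main.v *)
Require Import Defs.
From HB Require Import structures.
From mathcomp Require Import all_boot all_order all_algebra.
From mathcomp Require Import boolp classical_sets.

(** Let [P1] be properly contained in [P2] and let [Q1] lie over [P1]. A prime
    over [P2] above [Q1] is found by enlarging the ideal [Q1 + P2 O_w] to one
    that is maximal among the ideals avoiding the image of the complement of
    [P2] (lemma [prime_avoiding]). The only obstruction is that [Q1 + P2 O_w]
    may already meet that image. Divisibility in [O_v] is total, so such a
    meeting point can be divided by a scalar outside [P2], and it then says that
    [1 - p t] lies in [Q1] for some [p] in [P2] and [t] in [O_w]. Hence going
    up holds as soon as every such [1 - p t] is right invertible in [O_w]
    (lemma [going_up_of_inverses]).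

    The valuation hypotheses give this invertibility. Since [v p > 0] and the
    value monoid is cancellative, multiplication by [p t] strictly increases [w]
    on nonzero elements, on either side (lemma [quasi_valuation_lt_scale]). So
    no nonzero [x] satisfies [x = p t x] or [x = p x t], which means that
    [1 - p t] is regular, and a regular element of a one-sided artinian ring is
    invertible. The inverse [z] satisfies [z = 1 + p t z]; if [w z] were
    negative, this would force [w z >= w (p t z) > w z]. So [z] is in [O_w]. *)

Set Implicit Arguments.
Unset Strict Implicit.
Unset Printing Implicit Defensive.

Import GRing.Theory.
Import Order.TTheory.
Local Open Scope classical_set_scope.
Local Open Scope ring_scope.

(** * Prime ideals and going up *)

(** For central [c] the elements [x] with [c x] in [Q] form an ideal, so the
    ideal-wise definition of primeness can be applied to it and to [c T]. *)
Lemma prime_ideal_central (T : pzRingType) (Q : set T) (c x : T) :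
  prime_ideal Q -> (forall y, c * y = y * c) -> Q (c * x) -> Q c \/ Q x.
Proof.
move=> [[[Q0 QD Ql] [_ _ Qr]] _ Qprime] cC Qcx.
have [|||sub|sub] := Qprime [set y | exists t, y = c * t] [set y | Q (c * y)].
- split; split=> [|y z [t ->] [u ->]|a b].
  + by exists 0; rewrite mulr0.
  + by exists (t + u); rewrite mulrDr.
  + by move=> [t ->]; exists (a * t); rewrite mulrA -cC mulrA.
  + by exists 0; rewrite mulr0.
  + by exists (t + u); rewrite mulrDr.
  + by move=> [t ->]; exists (t * b); rewrite mulrA.
- split; split=> [|y z|a b] /=; rewrite ?mulr0 ?mulrDr //.
  + exact: QD.
  + by move=> Qy; rewrite mulrA cC -mulrA; apply: Ql.
  + exact: QD.
  + by move=> Qy; rewrite mulrA; apply: Qr.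
- by move=> _ y [t ->] /= Qy; rewrite cC -mulrA; apply: Ql.
- by left; apply: sub; exists 1; rewrite mulr1.
- by right; apply: sub.
Qed.

Lemma ideal_bigcup (T : pzRingType) (C : set (set T)) :
  C !=set0 -> total_on C subset -> (forall X, C X -> ideal X) ->
  ideal (\bigcup_(X in C) X).
Proof.
move=> [X0 CX0] Ctot Cid.
have U0 : (\bigcup_(X in C) X) 0.
  by exists X0 => //; case: (Cid _ CX0) => -[].
have UD x y : (\bigcup_(X in C) X) x -> (\bigcup_(X in C) X) y ->
    (\bigcup_(X in C) X) (x + y).
  move=> [X CX Xx] [Y CY Yy]; have [XY|YX] := Ctot _ _ CX CY.
  - by exists Y => //; case: (Cid _ CY) => -[_ D _] _; apply: D => //; apply: XY.
  - by exists X => //; case: (Cid _ CX) => -[_ D _] _; apply: D => //; apply: YX.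
split; split=> // a b [X CX Xx]; exists X => //; case: (Cid _ CX) => -[_ _ L] [_ _ R].
- exact: L.
- exact: R.
Qed.

Lemma ideal_add (T : pzRingType) (I J : set T) : ideal I -> ideal J ->
  ideal [set x | exists y z, [/\ I y, J z & x = y + z]].
Proof.
move=> [[I0 ID Il] [_ _ Ir]] [[J0 JD Jl] [_ _ Jr]].
have S0 : exists y z, [/\ I y, J z & 0 = y + z].
  by exists 0, 0; rewrite addr0.
have SD x x' : (exists y z, [/\ I y, J z & x = y + z]) ->
    (exists y z, [/\ I y, J z & x' = y + z]) ->
    exists y z, [/\ I y, J z & x + x' = y + z].
  move=> [y [z [Iy Jz ->]]] [y' [z' [Iy' Jz' ->]]].
  by exists (y + y'), (z + z'); rewrite addrACA; split; [apply: ID|apply: JD|].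
split; split=> //.
- move=> a _ [y [z [Iy Jz ->]]]; exists (a * y), (a * z).
  by rewrite mulrDr; split; [apply: Il|apply: Jl|].
- move=> _ a [y [z [Iy Jz ->]]]; exists (y * a), (z * a).
  by rewrite mulrDl; split; [apply: Ir|apply: Jr|].
Qed.

(** Krull's argument: an ideal maximal among those that contain [I0] and avoid
    the multiplicative set [S] is prime, because two ideals not contained in it
    both meet [S] once they are added to it, and so does their product. *)
Lemma prime_avoiding (T : pzRingType) (S I0 : set T) :
  S 1 -> (forall x y, S x -> S y -> S (x * y)) ->
  ideal I0 -> (forall x, I0 x -> ~ S x) ->
  exists Q, [/\ prime_ideal Q, I0 `<=` Q & forall x, Q x -> ~ S x].
Proof.
move=> S1 SM I0id I0S.
pose good X := [/\ ideal X, I0 `<=` X & forall x, X x -> ~ S x].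
have [|Q [[Qe|Qgood] Qmax]] := @Zorn_bigcup T [set X | X = set0 \/ good X].
- (* The empty set is admitted so that the empty chain has an upper bound;
     a nonempty union comes from the nonempty, hence good, members alone. *)
  move=> C CP Ctot.
  have [U0|/set0P[x0 [X0 CX0 X0x0]]] := eqVneq (\bigcup_(X in C) X) set0.
    by left.
  have Cgood X x : C X -> X x -> good X.
    by move=> CX Xx; case: (CP _ CX) => // E; rewrite E in Xx.
  right; pose C' := [set X | C X /\ X !=set0].
  have -> : \bigcup_(X in C) X = \bigcup_(X in C') X.
    apply/seteqP; split=> x [X]; last by move=> [CX _] Xx; exists X.
    by move=> CX Xx; exists X => //; split=> //; exists x.
  split.
  + apply: ideal_bigcup; first by exists X0; split=> //; exists x0.
      by move=> X Y [CX _] [CY _]; apply: Ctot.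
    by move=> X [CX [x Xx]]; case: (Cgood _ _ CX Xx).
  + move=> x I0x; exists X0; first by split=> //; exists x0.
    by case: (Cgood _ _ CX0 X0x0) => _ + _; apply.
  + by move=> x [X [CX _] Xx]; case: (Cgood _ _ CX Xx) => _ _; apply.
- exfalso; apply: (Qmax I0); last by right; split.
  rewrite Qe; split=> // sub; case: I0id => -[I00 _ _] _.
  exact: (sub _ I00).
have [Qid IQ QS] := Qgood; exists Q; split=> //; split=> // [QT|I J Iid Jid IJ].
  by apply: (QS 1) => //; rewrite QT.
have meets K : ideal K -> ~ K `<=` Q -> exists y z, [/\ Q y, K z & S (y + z)].
  move=> Kid KQ; apply: contrapT => no.
  have [[Q0 _ _] _] := Qid; have [[K0 _ _] _] := Kid.
  apply: (Qmax [set x | exists y z, [/\ Q y, K z & x = y + z]]).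
    split=> [x Qx|sub]; first by exists x, 0; rewrite addr0.
    by apply: KQ => x Kx; apply: sub; exists 0, x; rewrite add0r.
  right; split; first exact: ideal_add.
  + by move=> x I0x; exists x, 0; rewrite addr0; split=> //; apply: IQ.
  + by move=> x [y [z [Qy Kz ->]]] Sx; apply: no; exists y, z.
apply: contrapT => /not_orP[IQ' JQ'].
have [y [z [Qy Iz Syz]]] := meets _ Iid IQ'.
have [y' [z' [Qy' Jz' Syz']]] := meets _ Jid JQ'.
apply: (QS _ _ (SM _ _ Syz Syz')).
have [[_ QD Ql] [_ _ Qr]] := Qid.
rewrite mulrDr !mulrDl; apply: (QD); apply: (QD).
- exact: Ql.
- exact: Ql.
- exact: Qr.
- exact: IJ.
Qed.

(** Total divisibility lets a sum [p t + q u] be rewritten with a single scalar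
    from [P], so the single products already form the extended ideal [P T]. *)
Lemma ideal_extend_scale (A : comPzRingType) (T : algType A)
    (A_total : forall a b : A, (exists c, b = c * a) \/ (exists c, a = c * b))
    (P : set A) : ideal P ->
  ideal [set x : T | exists p t, P p /\ x = p *: t].
Proof.
move=> [[P0 PD _] [_ _ Pr]].
have S0 : exists p (t : T), P p /\ 0 = p *: t by exists 0, 0; rewrite scaler0.
have SD x x' : (exists p (t : T), P p /\ x = p *: t) ->
    (exists p t, P p /\ x' = p *: t) -> exists p t, P p /\ x + x' = p *: t.
  move=> [p [t [Pp ->]]] [q [u [Pq ->]]].
  have [[c ->]|[c ->]] := A_total p q.
  - by exists p, (t + c *: u); rewrite scalerDr scalerA (mulrC p).
  - by exists q, (c *: t + u); rewrite scalerDr scalerA (mulrC q).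
split; split=> //.
- by move=> a _ [p [t [Pp ->]]]; exists p, (a * t); rewrite scalerAr.
- by move=> _ a [p [t [Pp ->]]]; exists p, (t * a); rewrite scalerAl.
Qed.

(** A scalar [p] of [P2] is [s p'] with [p'] in [P2], for any [s] outside [P2].
    Hence a relation [s = q + p t] with [q] in [Q1] puts [s (1 - p' t)] into
    [Q1]. The image of [s] is central and not in [Q1], because [s] is outside
    [P1], so [1 - p' t] is in [Q1]; but [p'] is a nonunit, so [1 - p' t] has a
    right inverse and [Q1] would be everything. *)
Lemma going_up_of_inverses (A : comPzRingType) (T : algType A)
    (A_total : forall a b : A, (exists c, b = c * a) \/ (exists c, a = c * b))
    (T_inv : forall (p : A) (t : T), (forall a, a * p <> 1) ->
      exists z, (1 - p *: t) * z = 1) :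
  going_up A T.
Proof.
move=> P1 P2 P1prime P2prime [P12 P21] Q1 Q1prime Q1P1.
have Q1c c : Q1 c%:A <-> P1 c by rewrite Q1P1.
have [P2id P2T _] := P2prime; have [[P20 P2D P2l] [_ _ P2r]] := P2id.
have [Q1id Q1T _] := Q1prime; have [[Q10 Q1D Q1l] [_ _ Q1r]] := Q1id.
have Q1full : ~ Q1 1.
  by move=> Q11; apply: Q1T; apply/seteqP; split=> // x _; rewrite -(mulr1 x); apply: Q1l.
have P2full : ~ P2 1.
  by move=> P11; apply: P2T; apply/seteqP; split=> // x _; rewrite -(mulr1 x); apply: P2l.
pose I0 := [set x : T | exists y z, [/\ Q1 y,
  [set x : T | exists p t, P2 p /\ x = p *: t] z & x = y + z]].
pose S := [set x : T | exists2 s, ~ P2 s & x = s%:A].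
have [||||Q2 [Q2prime I0Q2 Q2S]] := @prime_avoiding T S I0.
- by exists 1; rewrite ?scale1r.
- move=> _ _ [a Pa ->] [b Pb ->]; exists (a * b); last first.
    by rewrite mulr_algl scalerA.
  by case/(prime_ideal_central P2prime) => // y; rewrite mulrC.
- exact/ideal_add/ideal_extend_scale.
- move=> _ [y [_ [Q1y [p [t [P2p ->]]] ->]]] [s P2s E].
  (* If [s] were a multiple of [p], it would be in [P2]. *)
  have [q P2q pE] : exists2 q, P2 q & p = s * q.
    have [[c cE]|[c cE]] := A_total p s.
      by case: P2s; rewrite cE; apply: P2l.
    exists c; last by rewrite mulrC.
    case: (prime_ideal_central P2prime (c := s) (x := c)) => //.
      by move=> d; rewrite mulrC.
    by rewrite mulrC -cE.
  have Q1s : Q1 (s%:A * (1 - q *: t)).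
    rewrite mulr_algl scalerBr scalerA -pE -E.
    by rewrite addrK.
  have [|z zE] := T_inv q t.
    by move=> a aq; apply: P2full; rewrite -aq; apply: P2l.
  case: (prime_ideal_central Q1prime _ Q1s) => [u|/Q1c/P12 //|Q1q].
    by rewrite mulr_algl mulr_algr.
  by apply: Q1full; rewrite -zE; apply: Q1r.
have I0alg c : P2 c -> Q2 c%:A.
  move=> P2c; apply: I0Q2; exists 0, c%:A; rewrite add0r; split=> //.
  by exists c, 1.
exists Q2; split=> //.
- apply/seteqP; split=> c /=; first exact: I0alg.
  by move=> Q2c; apply: contrapT => P2c; apply: (Q2S _ Q2c); exists c.
- split=> [x Q1x|Q21].
    apply: I0Q2; exists x, 0; rewrite addr0; split=> //.
    by exists 0, 0; rewrite scaler0.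
  by apply: P21 => c P2c; apply/Q1c/Q21/I0alg.
Qed.

(** * Regular elements of artinian rings *)

(** The descending chain of the ideals [y ^ n R], or [R y ^ n], stops, which
    gives a right, respectively left, inverse after cancelling a power of [y].
    Cancelling [y] itself turns a left inverse into a right one. *)
Lemma artinian_regular_right_inverse (R : pzRingType) (y : R) :
  right_artinian R \/ left_artinian R ->
  (forall x, y * x = 0 -> x = 0) -> (forall x, x * y = 0 -> x = 0) ->
  exists z, y * z = 1.
Proof.
move=> art yl yr.
have ylX n x : y ^+ n * x = 0 -> x = 0.
  by elim: n => [|n IH]; rewrite ?mul1r // exprS -mulrA => /yl.
have yrX n x : x * y ^+ n = 0 -> x = 0.
  by elim: n => [|n IH]; rewrite ?mulr1 // exprSr mulrA => /yr.
case: art => art.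
- have [n||n stop] := art (fun n => [set x | exists z, x = y ^+ n * z]).
  + split=> [|_ _ [z ->] [z' ->]|_ a [z ->]].
    * by exists 0; rewrite mulr0.
    * by exists (z + z'); rewrite mulrDr.
    * by exists (z * a); rewrite mulrA.
  + by move=> n _ [z ->]; exists (y * z); rewrite exprSr mulrA.
  have : [set x | exists z, x = y ^+ n * z] (y ^+ n) by exists 1; rewrite mulr1.
  rewrite -(stop n.+1 (leqnSn n)) => -[z zE]; exists z.
  apply/eqP; rewrite eq_sym -subr_eq0; apply/eqP/(ylX n).
  by rewrite mulrBr mulr1 mulrA -exprSr -zE subrr.
- have [n||n stop] := art (fun n => [set x | exists z, x = z * y ^+ n]).
  + split=> [|_ _ [z ->] [z' ->]|a _ [z ->]].
    * by exists 0; rewrite mul0r.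
    * by exists (z + z'); rewrite mulrDl.
    * by exists (a * z); rewrite mulrA.
  + by move=> n _ [z ->]; exists (z * y); rewrite exprS mulrA.
  have : [set x | exists z, x = z * y ^+ n] (y ^+ n) by exists 1; rewrite mul1r.
  rewrite -(stop n.+1 (leqnSn n)) => -[z zE]; exists z.
  have zy : z * y = 1.
    apply/eqP; rewrite eq_sym -subr_eq0; apply/eqP/(yrX n).
    by rewrite mulrBl mul1r -mulrA -exprS -zE subrr.
  apply/eqP; rewrite -subr_eq0; apply/eqP/yr.
  by rewrite mulrBl mul1r -mulrA zy mulr1 subrr.
Qed.

(** * Valuation rings *)

Lemma valuation_ring_dvd (F : fieldType) (G : orderedGroupType)
    (v : valuation F G) (a b : valuation_ring v) :
  v (val a) <= v (val b) -> exists c, b = c * a.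
Proof.
move=> ab; have [a0|a0] := eqVneq (val a) 0.
  exists 0; apply/val_inj; rewrite mul0r /=.
  apply/(valuation_eq_Infty v); move: ab; rewrite a0.
  by rewrite ((valuation_eq_Infty v 0).2 erefl); case: (v (val b)).
have c0 : val b / val a \in valuation_ring_pred v.
  have vb : v (val b) = v (val b / val a) + v (val a) by rewrite -valuationM divfK.
  rewrite inE; move: ab; rewrite vb.
  case E: (v (val a)) => [g|]; last first.
    by move/(valuation_eq_Infty v): E a0 => ->; rewrite eqxx.
  case: (v _) => //= c gc.
  by have := le_add2r (- g) (gc : g <= c + g); rewrite subrr addrK.
by exists (ValuationRing c0); apply/val_inj; rewrite /= divfK.
Qed.

Lemma valuation_ring_total (F : fieldType) (G : orderedGroupType)
    (v : valuation F G) (a b : valuation_ring v) :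
  (exists c, b = c * a) \/ (exists c, a = c * b).
Proof.
by have /orP[/valuation_ring_dvd|/valuation_ring_dvd] :=
  le_total (v (val a)) (v (val b)); [left|right].
Qed.

Lemma valuation_ring_nonunit (F : fieldType) (G : orderedGroupType)
    (v : valuation F G) (p : valuation_ring v) :
  (forall a, a * p <> 1) -> FinVal 0 < v (val p).
Proof.
move=> pN; rewrite ltNge; apply/negP => p0.
have [|c cE] := @valuation_ring_dvd _ _ v p 1; first by rewrite /= valuation1.
exact: (pN c).
Qed.

(** * Quasi-valuations with cancellative value monoid *)

Section Cancellative.
Variables (F : fieldType) (G : orderedGroupType) (v : valuation F G).
Variables (R : algType (valuation_ring v)) (M : orderedMonoidType).
Variables (i : ordered_embedding G M) (w : v_quasi_valuation R i).
Hypotheses (w1 : w 1 = 0) (w_finite : forall x : R, x != 0 -> w x <> Infty).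
Hypothesis Mw_cancellative : cancellative (value_monoid w).

Lemma value_monoid_val (x : R) (m : M) : w x = FinVal m -> value_monoid w m.
Proof.
move=> xm; apply: sub_gen_smallest; exists x => //.
have [w0 _ _] := v_quasi_valuationP w.
by apply/eqP => x0; move: xm; rewrite x0 w0.
Qed.

(** Cancellation turns the weak inequality [w x <= v p + w x] into a strict one,
    since [v p = w (p 1)] and [w x] both belong to the value monoid. *)
Lemma quasi_valuation_lt_scale (p : valuation_ring v) (x : R) :
  FinVal 0 < v (val p) -> x != 0 -> w x < w (p *: x).
Proof.
move=> p0 /w_finite; rewrite v_quasi_valuationZ.
case xE: (w x) => [m|//] _; case pE: (v (val p)) p0 => [g|//] g0.
have {}g0 : (0 : G) < g.
  by move: g0; rewrite !lt_neqAle => /andP[g1 g2]; apply/andP; split=> //;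
    apply: contra g1 => /eqP <-.
have ig : (0 : M) <= i g by rewrite -(embedding0 i) embedding_le ltW.
have mm : m <= i g + m by have := le_add2r m ig; rewrite add0r.
rewrite lt_neqAle; apply/andP; split; last exact: mm.
apply/eqP => -[mE].
have Mg : value_monoid w (i g).
  by apply: (@value_monoid_val (p *: 1)); rewrite v_quasi_valuationZ w1 pE addr0.
have M0 : value_monoid w 0 by apply: (@value_monoid_val 1).
have i0 : i g = 0.
  apply: (Mw_cancellative Mg M0 (value_monoid_val xE)).
  by rewrite add0r -mE.
have : i g <= i 0 by rewrite i0 embedding0.
by rewrite embedding_le leNgt g0.
Qed.

Lemma quasi_valuation_lt_scaleMl (p : valuation_ring v) (t x : R) :
  FinVal 0 < v (val p) -> FinVal 0 <= w t -> x != 0 -> w x < w (p *: (t * x)).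
Proof.
move=> p0 t0 x0; apply: lt_le_trans (quasi_valuation_lt_scale p0 x0) _.
have [_ wM _] := v_quasi_valuationP w.
rewrite !v_quasi_valuationZ ![_ + w _]addrC; apply/le_add2r/le_trans/wM.
by have := le_add2r (w x) t0; rewrite add0r.
Qed.

Lemma quasi_valuation_lt_scaleMr (p : valuation_ring v) (t x : R) :
  FinVal 0 < v (val p) -> FinVal 0 <= w t -> x != 0 -> w x < w (p *: (x * t)).
Proof.
move=> p0 t0 x0; apply: lt_le_trans (quasi_valuation_lt_scale p0 x0) _.
have [_ wM _] := v_quasi_valuationP w.
rewrite !v_quasi_valuationZ ![_ + w _]addrC; apply/le_add2r/le_trans/wM.
by have := le_add2r (w x) t0; rewrite add0r addrC.
Qed.

Lemma quasi_valuation_ring_inverse (p : valuation_ring v) (t : R) :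
  right_artinian R \/ left_artinian R -> FinVal 0 < v (val p) -> FinVal 0 <= w t ->
  exists2 z : R, FinVal 0 <= w z & (1 - p *: t) * z = 1.
Proof.
move=> art p0 t0.
have [x /eqP E|x /eqP E|z zE] := artinian_regular_right_inverse (y := 1 - p *: t) art.
- apply/eqP; apply: contraT => /(quasi_valuation_lt_scaleMl p0 t0).
  by move: E; rewrite mulrBl mul1r -scalerAl subr_eq0 => /eqP <-; rewrite ltxx.
- apply/eqP; apply: contraT => /(quasi_valuation_lt_scaleMr p0 t0).
  by move: E; rewrite mulrBr mulr1 -scalerAr subr_eq0 => /eqP <-; rewrite ltxx.
exists z => //; rewrite leNgt; apply/negP => z0.
have [w0 _ wD] := v_quasi_valuationP w.
have zN0 : z != 0 by apply: contraTneq z0 => ->; rewrite w0.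
have zE' : z = 1 + p *: (t * z).
  by rewrite -{1}zE mulrBl mul1r -scalerAl subrK.
have := wD 1 (p *: (t * z)); rewrite -zE' w1 ge_min leNgt z0 /=.
by rewrite leNgt quasi_valuation_lt_scaleMl.
Qed.

End Cancellative.

Theorem theorem4p12 (F : fieldType) (G : orderedGroupType)
  (v : valuation F G) (R : algType (valuation_ring v))
  (M : orderedMonoidType) (i : ordered_embedding G M)
  (w : v_quasi_valuation R i) (w1 : w 1 = 0)
  (v_nontrivial : nontrivial_valuation v)
  (w_finite : forall x : R, x != 0 -> w x <> Infty)
  (R_artinian : right_artinian R \/ left_artinian R)
  (Mw_cancellative : cancellative (value_monoid w)) :
  going_up (valuation_ring v) (quasi_valuation_ring w w1).
Proof.
apply: going_up_of_inverses => [a b|p t /valuation_ring_nonunit p0].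
  exact: valuation_ring_total.
have [|z z0 zE] := @quasi_valuation_ring_inverse _ _ _ _ _ _ _ w1 w_finite
  Mw_cancellative p (val t) R_artinian p0; first exact: (valP t).
have zP : z \in quasi_valuation_ring_pred w1 by [].
by exists (QuasiValuationRing zP); apply/val_inj.
Qed.
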